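(* Let $(X,T)$ be a discrete dynamical system, i.e. $X$ is a metric space with metric $d$ and $T:X\to X$ is a continuous map. If $(X,T)$ is sensitive and the set of periodic points of $T$ is dense in $X$, then $(X,T)$ is asymptotically sensitive.
   Context: Notation: $B_r(x)$ denotes the open ball of radius $r$ centered at $x\in X$, and $T^n$ denotes the $n$-fold iterate of $T$. Periodic point: a point $x\in X$ is periodic if $T^k(x)=x$ for some integer $k\ge 1$. Sensitive: $(X,T)$ is sensitive if there exists a constant $\delta>0$ such that for all $x\in X$ and all $\epsilon>0$ there are an integer $n>0$ and a pair of points $y,z\in B_\epsilon(x)$ with $d(T^n(z),T^n(y))>\delta$. Asymptotically sensitive: $(X,T)$ is asymptotically sensitive if there exists $\delta>0$ such that for all $x\in X$ and all $\epsilon>0$ there are points $y,z\in B_\epsilon(x)$ such that $d(T^{n}(y),T^{n}(z))>\delta$ for infinitely many positive integers $n$. *)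

(* Defs.v *)
From mathcomp Require Import all_boot all_order all_algebra.
From mathcomp Require Import all_classical all_reals all_analysis.
Set Implicit Arguments.
Unset Strict Implicit.
Unset Printing Implicit Defensive.
Import Order.TTheory GRing.Theory Num.Theory.
Local Open Scope classical_set_scope.
Local Open Scope ring_scope.

Definition periodic_points (X : Type) (T : X -> X) : set X :=
  [set x | exists k : nat, (1 <= k)%N /\ iter k T x = x].

Definition sensitive (R : realType) (X : metricType R) (T : X -> X) : Prop :=
  exists2 delta : R, 0 < delta &
    forall (x : X) (eps : R), 0 < eps ->
      exists (n : nat) (y z : X),
        [/\ (0 < n)%N, ball x eps y, ball x eps z &
            mdist (iter n T z) (iter n T y) > delta].

Definition asymptotically_sensitive (R : realType) (X : metricType R)
    (T : X -> X) : Prop :=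
  exists2 delta : R, 0 < delta &
    forall (x : X) (eps : R), 0 < eps ->
      exists y z : X,
        [/\ ball x eps y, ball x eps z &
            infinite_set [set n : nat | (0 < n)%N /\
              mdist (iter n T y) (iter n T z) > delta]].

(* Main.v *)
Require Import Defs.
From mathcomp Require Import all_boot all_order all_algebra.
From mathcomp Require Import all_classical all_reals all_analysis.
From mathcomp Require Import lra.
Import Order.TTheory GRing.Theory Num.Theory.
Local Open Scope classical_set_scope.
Local Open Scope ring_scope.

(** Sensitivity gives, in every ball, two points whose [n]-th iterates are more
    than [delta] apart. By continuity of the [n]-th iterate this strict
    inequality survives a small perturbation of the two points, so by density
    they may be replaced by periodic points of the same ball. If [k] and [l] are
    periods of these, the product [k * l] is a common period, and the same
    separation recurs at all the times [n + m * (k * l)]. Hence the sensitivity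
    constant itself serves for asymptotic sensitivity
    ([iter_period_shift], [periodic_near]). *)


Lemma iter_period_shift {X : Type} (T : X -> X) (x : X) (k n m : nat) :
  iter k T x = x -> iter (n + m * k) T x = iter n T x.
Proof.
move=> Tkx; rewrite iterD; congr (iter n T _).
by elim: m => [//|m IH]; rewrite mulSn iterD IH.
Qed.

Lemma continuous_iter {X : topologicalType} (T : X -> X) (n : nat) :
  continuous T -> continuous (iter n T).
Proof.
move=> Tc; elim: n => [|n IH] x; first exact: cvg_id.
exact: (@continuous_comp _ _ _ (iter n T) T x (IH x) (Tc _)).
Qed.

Lemma dense_nbhs {X : topologicalType} (S U : set X) (x : X) :
  dense S -> nbhs x U -> U `&` S !=set0.
Proof.
move=> Sd xU; have [|y [yU Sy]] := Sd (interior U) _ (open_interior U); first by exists x.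
by exists y; split=> //; exact: interior_subset.
Qed.

Lemma nbhs_ball_of_mem {R : realType} {X : metricType R} (x y : X) (eps : R) :
  ball x eps y -> nbhs y (ball x eps).
Proof.
rewrite ballEmdist /= => xy; apply/nbhs_ballP.
exists (eps - mdist x y); first by rewrite /= subr_gt0.
move=> z; rewrite ballEmdist /= => yz.
have := metric_triangle x y z; lra.
Qed.

(** The perturbation step: every point of a ball can be traded for a periodic
    point of the same ball whose [n]-th iterate is as close as desired. *)
Lemma periodic_near {R : realType} {X : metricType R} (T : X -> X)
    (x y : X) (eps e : R) (n : nat) :
  continuous T -> dense (periodic_points T) -> ball x eps y -> 0 < e ->
  exists p : X, [/\ ball x eps p, mdist (iter n T y) (iter n T p) < e &
    periodic_points T p].
Proof.
move=> Tc Td xy e0.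
have near_image : nbhs y (iter n T @^-1` ball (iter n T y) e).
  by apply: (continuous_iter T n Tc y); exact: nbhsx_ballx.
have [p [[xp yp] pp]] :=
  dense_nbhs _ _ _ Td (filterI (nbhs_ball_of_mem _ _ _ xy) near_image).
by exists p; split=> //; move: yp; rewrite /= ballEmdist.
Qed.

Lemma infinite_set_progression (A : set nat) (n k : nat) :
  (0 < k)%N -> (forall m, A (n + m * k)%N) -> infinite_set A.
Proof.
move=> k0 An Afin; apply: infinite_nat.
have -> : [set: nat] = (fun m => (n + m * k)%N) @^-1` A.
  by apply/seteqP; split=> // m _; exact: An.
apply: finite_preimage Afin => m m' _ _ /addnI /eqP.
by rewrite eqn_pmul2r // => /eqP.
Qed.

Theorem mainTheorem1 (R : realType) (X : metricType R) (T : X -> X)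
    (T_cont : continuous T) (T_sens : sensitive T)
    (T_per : dense (periodic_points T)) :
  asymptotically_sensitive T.
Proof.
have [delta delta0 sens] := T_sens; exists delta => // x eps eps0.
have [n [y [z [n0 xy xz dzy]]]] := sens x eps eps0.
(* Moving each of the two images by less than half of the excess over delta
   keeps them more than delta apart. *)
pose e := (mdist (iter n T z) (iter n T y) - delta) / 2.
have e0 : 0 < e by rewrite /e; lra.
have [p [xp yp [k [k0 Tkp]]]] := periodic_near T x y eps e n T_cont T_per xy e0.
have [q [xq zq [l [l0 Tlq]]]] := periodic_near T x z eps e n T_cont T_per xz e0.
have dpq : delta < mdist (iter n T p) (iter n T q).
  have := metric_triangle (iter n T z) (iter n T q) (iter n T y).
  have := metric_triangle (iter n T q) (iter n T p) (iter n T y).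
  rewrite (metric_sym (iter n T q) (iter n T p)) (metric_sym (iter n T p) (iter n T y)).
  by move: yp zq; rewrite /e; lra.
exists p, q; split=> //.
apply: (@infinite_set_progression _ n (k * l)); first by rewrite muln_gt0 k0.
move=> m; split; first by rewrite addn_gt0 n0.
have -> : iter (n + m * (k * l)) T p = iter n T p.
  by rewrite (mulnC k) mulnA; exact: iter_period_shift.
by rewrite mulnA (iter_period_shift T q).
Qed.
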